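(* Let $H_1, H_2$ be complex Hilbert spaces and let $X \in B(H_2, H_1)$, $Y \in B(H_1, H_2)$. Then \[ w^4\begin{pmatrix} 0 & X \\ Y & 0 \end{pmatrix} \leq \frac{1}{16}\|S\|^2+\frac{1}{4}w^2(YX)+\frac{1}{8}w(YXS+SYX), \] where $S=|X|^2+|Y^{*}|^2 \in B(H_2)$.
   Context: $B(H_1,H_2)$ denotes the set of all bounded linear operators from the complex Hilbert space $H_1$ to the complex Hilbert space $H_2$, and $B(H)=B(H,H)$. For an operator $T$, $\|T\|$ is the operator norm and $|T|^2=T^{*}T$ (so $|X|^2=X^*X$ and $|Y^*|^2=YY^*$). The numerical radius of $T\in B(H)$ is $w(T)=\sup\{|\langle Tx,x\rangle| : x\in H,\ \|x\|=1\}$; $w^k(T)$ means $(w(T))^k$. The operator matrix $\begin{pmatrix} 0 & X \\ Y & 0\end{pmatrix}$ acts on the Hilbert space direct sum $H_1\oplus H_2$ by $(x_1,x_2)\mapsto (Xx_2, Yx_1)$. *)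

(* Defs.v *)
From HB Require Import structures.
From mathcomp Require Import all_boot all_order all_algebra.
From mathcomp Require Import all_classical all_reals all_analysis.
From mathcomp Require Import complex.
From mathcomp Require Import ring.
Set Implicit Arguments.
Unset Strict Implicit.
Unset Printing Implicit Defensive.
Import Order.TTheory GRing.Theory Num.Theory.
Import numFieldNormedType.Exports.
Local Open Scope classical_set_scope.
Local Open Scope ring_scope.
Local Open Scope complex_scope.

(* The inner product is linear in its first argument and conjugate-linear in
   its second one; the norm is the library's, with values in [R[i]]. *)
HB.mixin Record isHilbert (R : realType) H & CompleteNormedModule R[i] H := {
  inner : {dot H for @Num.conj R[i]} ;
  sqr_norm_inner : forall x : H, `|x| ^+ 2 = inner x x
}.

#[short(type="hilbertType")]
HB.structure Definition Hilbert (R : realType) :=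
  {H of CompleteNormedModule R[i] H & isHilbert R H}.

(* The product type [H1 * H2] already carries the sup norm in the library,
   hence an alias for the Hilbert space direct sum. *)
Definition hsum (R : realType) (H1 H2 : hilbertType R) : Type := (H1 * H2)%type.

Section HilbertSum.
Variables (R : realType) (H1 H2 : hilbertType R).
Notation H := (hsum H1 H2).

HB.instance Definition _ := GRing.Lmodule.copy H (H1 * H2)%type.

Definition hsum_inner (x y : H) : R[i] :=
  @inner R H1 x.1 y.1 + @inner R H2 x.2 y.2.

Let hsum_innerDl (z : H) : zmod_morphism (hsum_inner^~ z).
Proof. by move=> x y; rewrite /hsum_inner !linearBl opprD addrACA. Qed.

Let hsum_innerDr (z : H) : zmod_morphism (hsum_inner z).
Proof. by move=> x y; rewrite /hsum_inner !linearBr opprD addrACA. Qed.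

Let hsum_innerZl (z : H) : scalable_for *%R (hsum_inner^~ z).
Proof. by move=> a x; rewrite /hsum_inner !linearZl_LR mulrDr. Qed.

Let hsum_innerZr (z : H) : scalable_for (@Num.conj R[i] \; *%R) (hsum_inner z).
Proof. by move=> a x; rewrite /hsum_inner !linearZr_LR /= mulrDr. Qed.

HB.instance Definition _ := isBilinear.Build R[i] H H R[i]
  *%R (@Num.conj R[i] \; *%R) hsum_inner
  hsum_innerDl hsum_innerDr hsum_innerZl hsum_innerZr.

Let hsum_inner_herm (x y : H) :
  hsum_inner x y = (-1) ^+ false * (hsum_inner y x)^*%R.
Proof.
rewrite expr0 mul1r /hsum_inner rmorphD.
by congr (_ + _); rewrite hermC expr0 mul1r.
Qed.

HB.instance Definition _ :=
  isHermitianSesquilinear.Build R[i] H false (@Num.conj R[i]) hsum_inner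
    hsum_inner_herm.

Let hsum_inner_gt0 (x : H) : x != 0 -> 0 < hsum_inner x x.
Proof.
rewrite /hsum_inner -!sqr_norm_inner; case: x => x y /= xy0.
have [x0|x0] := eqVneq x 0.
  rewrite x0 normr0 expr0n add0r exprn_gt0// normr_gt0.
  by apply: contra_neq xy0 => ->; rewrite x0.
by rewrite ltr_wpDr ?exprn_ge0// exprn_gt0// normr_gt0.
Qed.

HB.instance Definition _ := isDotProduct.Build R[i] H hsum_inner hsum_inner_gt0.

Definition hsum_norm (x : H) : R[i] := sqrtC (hsum_inner x x).

Let sqrtC_minkowski (a b c d : R[i]) :
    0 <= a -> 0 <= b -> 0 <= c -> 0 <= d ->
  sqrtC ((a + c) ^+ 2 + (b + d) ^+ 2) <=
  sqrtC (a ^+ 2 + b ^+ 2) + sqrtC (c ^+ 2 + d ^+ 2).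
Proof.
move=> a0 b0 c0 d0.
have sq_ge0 (u v : R[i]) : 0 <= u -> 0 <= v -> 0 <= u ^+ 2 + v ^+ 2.
  by move=> u0 v0; rewrite addr_ge0// exprn_ge0.
rewrite -(@ler_pXn2r _ 2%N) ?nnegrE ?addr_ge0 ?sqrtC_ge0 ?sq_ge0 ?addr_ge0//.
rewrite [leRHS]sqrrD !sqrtCK -sqrtCM ?nnegrE ?sq_ge0//.
rewrite (_ : (a + c) ^+ 2 + (b + d) ^+ 2 =
  a ^+ 2 + b ^+ 2 + (a * c + b * d) *+ 2 + (c ^+ 2 + d ^+ 2)); last by ring.
rewrite lerD2r lerD2l lerMn2r /=.
rewrite -(@ler_pXn2r _ 2%N) ?nnegrE ?sqrtC_ge0 ?addr_ge0 ?mulr_ge0 ?sq_ge0//.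
rewrite sqrtCK -subr_ge0.
rewrite (_ : _ - _ = (a * d - b * c) ^+ 2); last by ring.
by rewrite real_exprn_even_ge0// rpredB// rpredM// ger0_real.
Qed.

Let hsum_normE (x : H) : hsum_norm x = sqrtC (`|x.1| ^+ 2 + `|x.2| ^+ 2).
Proof. by rewrite !sqr_norm_inner. Qed.

Let hsum_normD (x y : H) : hsum_norm (x + y) <= hsum_norm x + hsum_norm y.
Proof.
rewrite !hsum_normE /=; apply: le_trans (sqrtC_minkowski _ _ _ _) => //.
by rewrite ler_sqrtC ?nnegrE ?addr_ge0 ?exprn_ge0 ?lerD ?lerXn2r
  ?nnegrE ?addr_ge0 ?ler_normD.
Qed.

Let hsum_normZ (a : R[i]) (x : H) : hsum_norm (a *: x) = `|a| * hsum_norm x.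
Proof.
rewrite /hsum_norm linearZl_LR linearZr_LR /= mulrA -normCK.
by rewrite rootCMl ?exprn_ge0// sqrCK.
Qed.

Let hsum_norm0_eq0 (x : H) : hsum_norm x = 0 -> x = 0.
Proof.
move=> /eqP; rewrite sqrtC_eq0; apply: contraTeq => /hsum_inner_gt0.
by rewrite lt_def => /andP[].
Qed.

HB.instance Definition _ := Lmodule_isNormed.Build R[i] H
  hsum_normD hsum_normZ hsum_norm0_eq0.

Let hsum_norm2 (x : H) : `|x| ^+ 2 = `|x.1| ^+ 2 + `|x.2| ^+ 2.
Proof. by rewrite {1}/Num.norm /= sqrtCK !sqr_norm_inner. Qed.

Let norm_fst (x : H) : `|x.1| <= `|x|.
Proof.
by rewrite -(@ler_pXn2r _ 2%N) ?nnegrE// hsum_norm2 lerDl exprn_ge0.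
Qed.

Let norm_snd (x : H) : `|x.2| <= `|x|.
Proof.
by rewrite -(@ler_pXn2r _ 2%N) ?nnegrE// hsum_norm2 lerDr exprn_ge0.
Qed.

Let norm_hsum (x : H) : `|x| <= `|x.1| + `|x.2|.
Proof.
rewrite -(@ler_pXn2r _ 2%N) ?nnegrE ?addr_ge0// hsum_norm2.
by rewrite sqrrD addrAC lerDl mulrn_wge0// mulr_ge0.
Qed.

Let hsum_complete (F : set_system H) : ProperFilter F -> cauchy F -> cvg F.
Proof.
move=> FF /cauchyP Fc.
have cvg_proj (K : hilbertType R) (p : H -> K) : {morph p : x y / x - y} ->
    (forall x : H, `|p x| <= `|x|) -> cvg (p @ F).
  move=> pB ple; apply: cauchy_cvg; apply: cauchy_exP => e e0.
  have [z Fz] := Fc e e0; exists (p z).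
  rewrite /fmap /=; apply: filterS Fz => y.
  rewrite -!ball_normE /ball_ /= => zy.
  by apply: le_lt_trans zy; rewrite -pB ple.
have /cvg_ex[/= a Fa] := cvg_proj H1 fst (fun _ _ => erefl) norm_fst.
have /cvg_ex[/= b Fb] := cvg_proj H2 snd (fun _ _ => erefl) norm_snd.
apply/cvg_ex; exists ((a, b) : H).
apply/cvg_ballP => e e0.
have e20 : 0 < e / 2%:R by rewrite divr_gt0.
move/cvg_ballP : Fa => /(_ _ e20) Fa; move/cvg_ballP : Fb => /(_ _ e20) Fb.
apply: filterS2 Fa Fb => x; rewrite -!ball_normE /ball_ /= => ax bx.
apply: le_lt_trans (norm_hsum _) _.
by rewrite [ltRHS]splitr ltrD.
Qed.

HB.instance Definition _ := Uniform_isComplete.Build H hsum_complete.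

Let hsum_sqr_norm (x : H) : `|x| ^+ 2 = hsum_inner x x.
Proof. by rewrite {1}/Num.norm /= sqrtCK. Qed.

HB.instance Definition _ := isHilbert.Build R H hsum_sqr_norm.

End HilbertSum.

Section Operators.
Variable R : realType.
Implicit Types H : hilbertType R.

Definition bounded_op H1 H2 (T : H1 -> H2) : Prop :=
  exists M : R, forall x, `|T x| <= M%:C * `|x|.

(* For bounded linear [T], the vector below exists by the Riesz representation
   theorem, and it is unique since the inner product is definite. *)
Definition adjoint H1 H2 (T : H1 -> H2) : H2 -> H1 :=
  fun y => get [set z : H1 | forall x : H1, inner (T x) y = inner x z].

(* Norms have values in [R[i]]; [complex.Re] sends them to [R], where [sup]
   is available. *)
Definition opnorm H1 H2 (T : H1 -> H2) : R :=
  sup [set complex.Re `|T x| | x in [set x : H1 | `|x| <= 1]].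

Definition numradius H (T : H -> H) : R :=
  sup [set complex.Re `|inner (T x) x| | x in [set x : H | `|x| = 1]].

Definition abs2 H1 H2 (T : H1 -> H2) : H1 -> H1 := adjoint T \o T.

(* The operator matrix with zero diagonal blocks and upper right block [X],
   lower left block [Y]. *)
Definition offdiag H1 H2 (X : H2 -> H1) (Y : H1 -> H2) :
    hsum H1 H2 -> hsum H1 H2 :=
  fun v => (X v.2, Y v.1).

End Operators.

(* Main.v *)
From HB Require Import structures.
Require Import Defs.
From mathcomp Require Import all_boot all_order all_algebra.
From mathcomp Require Import all_classical all_reals all_analysis.
From mathcomp Require Import complex.
From mathcomp Require Import ring lra.
Import Order.TTheory GRing.Theory Num.Theory.
Import numFieldNormedType.Exports.
Local Open Scope classical_set_scope.
Local Open Scope ring_scope.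
Local Open Scope complex_scope.
Set Implicit Arguments.
Unset Strict Implicit.
Unset Printing Implicit Defensive.

(** Write [T] for the off-diagonal operator, [X'] and [Y'] for the adjoints of
    [X] and [Y], [G = Y X], and let [v = (x, y)] be a unit vector.  For a
    complex number [e] of modulus 1 that turns [<T v, v>] into its modulus,
      [|<T v, v>| = Re <A y, x>] with [A = e X + conj(e) Y'],
    which is at most [|A y| |x|], while [|x| |y| <= 1/2] because
    [|x|^2 + |y|^2 = 1].  It remains to bound [|A y|^4] by [C |y|^4], with [C]
    equal to 16 times the right-hand side ([rnorm_block_le]).  Expanding the
    square,
      [|A y|^2 = <(S + K) y, y>] with [K = c G + conj(c) G'] and [c = e^2]
    ([sqr_rnorm_block]), so [|A y|^4 <= |(S + K) y|^2 |y|^2], and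
      [|(S + K) y|^2 = |S y|^2 + |K y|^2 + 2 Re <S y, K y>].
    The three terms give the three terms of [C].  The first is controlled by
    the operator norm of [S].  In the second, [K] is self-adjoint and the
    modulus of its quadratic form [2 Re (c <G y, y>)] is at most
    [2 w(G) |y|^2]; by polarization such a bound on the form is a bound on the
    norm ([selfadjoint_norm_le], [rotated_real_part_le]).  In the third,
    moving [S] and [G'] across the inner product shows that
    [Re <S y, K y> = Re (c <(G S + S G) y, y>)], which the numerical radius
    of [G S + S G] controls.

    All of this rests on adjoints satisfying their defining identity, hence
    on the Riesz representation theorem, proved here by minimizing
    [|x|^2 - 2 g x] over the Hilbert space ([riesz_real]). *)

(** * Real-valued norms and real parts *)

Section ComplexNumbers.
Variable R : realType.
Implicit Types (z : R[i]) (r : R).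

Lemma ReD z1 z2 : complex.Re (z1 + z2) = complex.Re z1 + complex.Re z2.
Proof. by case: z1 z2 => [? ?] [? ?]. Qed.

Lemma ReN z : complex.Re (- z) = - complex.Re z.
Proof. by case: z. Qed.

Lemma ReMr r z : complex.Re (r%:C * z) = r * complex.Re z.
Proof. by case: z => [a b] /=; rewrite mul0r subr0. Qed.

Lemma ReJ z : complex.Re z^*%R = complex.Re z.
Proof. by case: z. Qed.

(** Taking [c] to be [1] and ['i] recovers the real and imaginary parts; this
    lifts real identities to complex ones. *)
Lemma Re_scale_eq0 z : (forall c, complex.Re (c * z) = 0) -> z = 0.
Proof.
case: z => a b h; have /= := h 1; have /= := h 'i.
rewrite mul0r mul1r sub0r => /eqP; rewrite oppr_eq0 => /eqP ->.
by rewrite mul1r mul0r subr0 => ->.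
Qed.

(** Norms on the spaces considered here live in [R[i]], where only real numbers
    are comparable; taking real parts puts the estimates in the ordered field
    [R].  The scalars are themselves an instance of [V], so this is also the
    modulus. *)
Definition rnorm (V : normedZmodType R[i]) (x : V) : R := complex.Re `|x|.

Lemma rnormE (V : normedZmodType R[i]) (x : V) : (rnorm x)%:C = `|x|.
Proof. by rewrite RRe_real// ger0_real. Qed.

Lemma rnorm_ge0 (V : normedZmodType R[i]) (x : V) : 0 <= rnorm x.
Proof. by rewrite -ler0c rnormE. Qed.

Lemma rnorm_eq0 (V : normedZmodType R[i]) (x : V) : (rnorm x == 0) = (x == 0).
Proof. by rewrite -(inj_eq (@complexI R)) rnormE normr_eq0. Qed.

Lemma rnorm_triangle (V : normedZmodType R[i]) (x y : V) :
  rnorm (x + y) <= rnorm x + rnorm y.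
Proof. by rewrite -lecR rmorphD /= !rnormE ler_normD. Qed.

Lemma rnormM z1 z2 : rnorm (z1 * z2) = rnorm z1 * rnorm z2.
Proof. by apply: complexI; rewrite rmorphM /= !rnormE normrM. Qed.

Lemma Re_le_rnorm z : complex.Re z <= rnorm z.
Proof.
apply: le_trans (ler_norm _) _.
by rewrite -lecR rnormE normc_ge_Re.
Qed.

Lemma rnorm_conj z : rnorm z^*%R = rnorm z.
Proof. by rewrite /rnorm norm_conjC. Qed.

Lemma rnorm_real r : rnorm r%:C = `|r|.
Proof.
by apply: complexI; rewrite rnormE normc_def /= expr0n addr0 sqrtr_sqr.
Qed.

(** Modulus as a real part: this replaces suprema over all rotations. *)
Lemma phase z : exists2 e : R[i], rnorm e = 1 & complex.Re (e * z) = rnorm z.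
Proof.
have [->|z0] := eqVneq z 0.
  exists 1; first by apply: complexI; rewrite rnormE normr1.
  by rewrite mulr0 /rnorm normr0.
exists (z^*%R / `|z|).
  apply: complexI.
  by rewrite rnormE normrM norm_conjC normfV normr_id divff ?normr_eq0.
rewrite mulrAC (mulrC _ z) -normCK expr2 mulfK ?normr_eq0//.
Qed.

Lemma unit_conjK (e : R[i]) : rnorm e = 1 -> e * e^*%R = 1.
Proof. by rewrite -normCK -rnormE => ->; rewrite expr1n. Qed.

End ComplexNumbers.

(** * The real inner product and completeness *)

Section InnerProduct.
Variables (R : realType) (H : hilbertType R).
Implicit Types x y z : H.

Lemma innerC x y : inner x y = (inner y x)^*%R.
Proof. by rewrite hermC expr0 mul1r. Qed.

Lemma innerDl x y z : inner (x + y) z = inner x z + inner y z.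
Proof. exact: linearDl. Qed.
Lemma innerDr x y z : inner z (x + y) = inner z x + inner z y.
Proof. exact: linearDr. Qed.
Lemma innerZl a x y : inner (a *: x) y = a * inner x y.
Proof. exact: linearZl_LR. Qed.
Lemma innerZr a x y : inner x (a *: y) = a^*%R * inner x y.
Proof. exact: linearZr_LR. Qed.

Lemma inner_injr x y : (forall z, inner z x = inner z y) -> x = y.
Proof.
move=> h; apply/eqP; rewrite -subr_eq0 -(dnorm_eq0 (@inner R H)).
by rewrite linearBr /= h subrr.
Qed.

(** [H] is also a real Hilbert space for this inner product, with the same
    norm. *)
Definition rdot x y : R := complex.Re (inner x y).

Lemma rdotC x y : rdot x y = rdot y x.
Proof. by rewrite /rdot innerC ReJ. Qed.
Lemma rdotDl x y z : rdot (x + y) z = rdot x z + rdot y z.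
Proof. by rewrite /rdot innerDl ReD. Qed.
Lemma rdotDr x y z : rdot z (x + y) = rdot z x + rdot z y.
Proof. by rewrite /rdot innerDr ReD. Qed.
Lemma rdotNl x y : rdot (- x) y = - rdot x y.
Proof. by rewrite -scaleN1r /rdot innerZl mulN1r ReN. Qed.
Lemma rdotNr x y : rdot x (- y) = - rdot x y.
Proof. by rewrite rdotC rdotNl rdotC. Qed.
Lemma rdotZl r x y : rdot (r%:C *: x) y = r * rdot x y.
Proof. by rewrite /rdot innerZl ReMr. Qed.
Lemma rdotZr r x y : rdot x (r%:C *: y) = r * rdot x y.
Proof. by rewrite rdotC rdotZl rdotC. Qed.

Definition rdotE := (rdotDl, rdotDr, rdotNl, rdotNr, rdotZl, rdotZr).

Lemma sqr_rnorm x : rnorm x ^+ 2 = rdot x x.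
Proof.
apply: complexI; rewrite expr2 rmorphM /= rnormE -expr2 sqr_norm_inner.
by rewrite RRe_real// ger0_real// dnorm_ge0.
Qed.

Lemma rnormZ a x : rnorm (a *: x) = rnorm a * rnorm x.
Proof. by apply: complexI; rewrite rmorphM /= !rnormE normrZ. Qed.

(** Expanding [| |y| x - |x| y |^2 >= 0] gives [2 |x|^2 |y|^2] at least
    [2 |x| |y|] times the inner product. *)
Lemma rdot_le x y : rdot x y <= rnorm x * rnorm y.
Proof.
have [->|x0] := eqVneq x 0.
  by rewrite /rdot linear0l mulr_ge0 ?rnorm_ge0.
have [->|y0] := eqVneq y 0.
  by rewrite /rdot linear0r mulr_ge0 ?rnorm_ge0.
have a0 : 0 < rnorm x by rewrite lt_def rnorm_eq0 x0 rnorm_ge0.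
have b0 : 0 < rnorm y by rewrite lt_def rnorm_eq0 y0 rnorm_ge0.
have := sqr_ge0 (rnorm ((rnorm y)%:C *: x - (rnorm x)%:C *: y)).
rewrite sqr_rnorm !rdotE (rdotC y x) -!sqr_rnorm => h.
rewrite -(ler_pM2l (mulr_gt0 a0 b0)); nra.
Qed.

Lemma rnorm_inner x y : rnorm (inner x y) <= rnorm x * rnorm y.
Proof.
have [e e1 <-] := phase (inner x y).
rewrite -innerZl; apply: le_trans (rdot_le _ _) _.
by rewrite rnormZ e1 mul1r.
Qed.

Lemma rdot_unimodular x y (e : R[i]) :
  rnorm e = 1 -> rdot (e *: x) (e *: y) = rdot x y.
Proof. by move=> e1; rewrite /rdot innerZl innerZr mulrA unit_conjK ?mul1r. Qed.

Lemma parallelogram x y :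
  rnorm (x + y) ^+ 2 + rnorm (x - y) ^+ 2 = 2 * (rnorm x ^+ 2 + rnorm y ^+ 2).
Proof. by rewrite !sqr_rnorm !rdotE (rdotC y x); ring. Qed.

(** Completeness in terms of the real-valued norm; an explicit modulus [e] is
    what a minimizing sequence provides. *)
Lemma cauchy_rnorm_cvg (u : nat -> H) (e : nat -> R) :
  (forall n m k, (n <= m)%N -> (n <= k)%N -> rnorm (u m - u k) <= e n) ->
  (forall eps, 0 < eps -> exists n, e n < eps) ->
  exists z, forall eps, 0 < eps ->
    exists N, forall n, (N <= n)%N -> rnorm (z - u n) < eps.
Proof.
move=> hu he.
have : cvg (u @ \oo).
  apply: cauchy_cvg; apply: cauchy_exP => d d0.
  have dE : d = (complex.Re d)%:C by rewrite RRe_real// gtr0_real.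
  have [n en] : exists n, e n < complex.Re d by apply: he; rewrite -ltcR -dE.
  exists (u n); exists n => // m /= nm.
  rewrite -ball_normE /ball_ /= -rnormE dE ltcR.
  exact: le_lt_trans (hu n n m (leqnn _) nm) en.
move=> /cvg_ex[/= z uz]; exists z => eps eps0.
have eps0C : 0 < eps%:C :> R[i] by rewrite ltcR.
have /cvg_ballP /(_ _ eps0C)[N _ hN] := uz.
exists N => n Nn; have := hN n Nn.
by rewrite -ball_normE /ball_ /= -rnormE ltcR.
Qed.

End InnerProduct.

(** * Riesz representation *)

Section Riesz.
Variables (R : realType) (H : hilbertType R).

(** The minimizer [z] of [J x = |x|^2 - 2 g x] represents [g].  A minimizing
    sequence is Cauchy by the parallelogram law, because the midpoint of two
    almost-minimizers cannot do better than the infimum.  At its limit the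
    increment [|h|^2 + 2 (<h, z> - g h)] of [J] is nonnegative for every [h],
    and its linear part must then vanish. *)
Lemma riesz_real (g : H -> R) (M : R) :
  (forall x y, g (x + y) = g x + g y) ->
  (forall (r : R) x, g (r%:C *: x) = r * g x) ->
  (forall x, g x <= M * rnorm x) ->
  exists z, forall x, g x = rdot x z.
Proof.
move=> gD gZ gM.
pose J x := rnorm x ^+ 2 - 2 * g x.
have Jlb x : - M ^+ 2 <= J x.
  by rewrite /J; have := gM x; have := sqr_ge0 (rnorm x - M); nra.
have JD x h : J (x + h) = J x + rnorm h ^+ 2 + 2 * (rdot h x - g h).
  by rewrite /J !sqr_rnorm !rdotE (rdotC h x) gD; ring.
have Jmid x y : rnorm (x - y) ^+ 2 =
    2 * (J x + J y) - 4 * J ((2^-1 : R)%:C *: (x + y)).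
  have n2 : rnorm (2^-1 : R)%:C = 2^-1 by rewrite rnorm_real ger0_norm.
  rewrite /J rnormZ n2 gZ gD exprMn.
  have := parallelogram x y.
  set a := rnorm (x - y) ^+ 2; set b := rnorm (x + y) ^+ 2 => h.
  rewrite (_ : a = 2 * (rnorm x ^+ 2 + rnorm y ^+ 2) - b); first by field.
  by rewrite -h addrC addKr.
have infJ : has_inf (range J).
  split; first by exists (J 0), 0.
  by exists (- M ^+ 2) => _ [x _ <-].
pose m := inf (range J).
have mJ x : m <= J x by apply: ge_inf infJ.2 _ _; exists x.
have eps_gt0 n : (0 : R) < n.+1%:R^-1 by rewrite invr_gt0 ltr0n.
have /choice[u hu] : forall n, exists x, J x < m + n.+1%:R^-1.
  by move=> n; have [_ [x _ <-] h] := inf_adherent (eps_gt0 n) infJ; exists x.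
have inv_small eps : 0 < eps -> exists n, n.+1%:R^-1 < eps :> R.
  move=> e0; have [n _ h] := near_infty_natSinv_lt (PosNum e0).
  by exists n; apply: h => /=.
have inv_mono n k : (n <= k)%N -> k.+1%:R^-1 <= n.+1%:R^-1 :> R.
  by move=> nk; rewrite lef_pV2 ?posrE ?ltr0n// ler_nat.
have [z uz] : exists z, forall eps, 0 < eps ->
    exists N, forall n, (N <= n)%N -> rnorm (z - u n) < eps.
  apply: (@cauchy_rnorm_cvg _ _ _ (fun n => 2 * Num.sqrt (n.+1%:R^-1))).
    move=> n j k nj nk.
    rewrite -(@ler_pXn2r _ 2) ?nnegrE ?mulr_ge0 ?rnorm_ge0 ?sqrtr_ge0//.
    rewrite exprMn sqr_sqrtr ?(ltW (eps_gt0 n))// Jmid.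
    have := mJ ((2^-1 : R)%:C *: (u j + u k)).
    have := hu j; have := hu k; have := inv_mono _ _ nj; have := inv_mono _ _ nk.
    rewrite expr2.
    by move: (n.+1%:R^-1 : R) (k.+1%:R^-1 : R) (j.+1%:R^-1 : R) => a b c; lra.
  move=> eps e0.
  have e20 : 0 < (eps / 2) ^+ 2 by rewrite exprn_gt0// divr_gt0.
  have [n hn] := inv_small _ e20; exists n.
  have : Num.sqrt (n.+1%:R^-1) < Num.sqrt ((eps / 2) ^+ 2) by rewrite ltr_sqrt.
  rewrite sqrtr_sqr ger0_norm ?divr_ge0 ?ltW//; lra.
exists z => x.
(* A negative increment [d] at [z] would persist at [u k] for large [k], by
   continuity of the inner product, and push [J] below its infimum. *)
have quad h : 0 <= rnorm h ^+ 2 + 2 * (rdot h z - g h).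
  rewrite leNgt; apply/negP => lt0.
  set d := rnorm h ^+ 2 + 2 * (rdot h z - g h) in lt0.
  have nh := rnorm_ge0 h.
  have e0 : 0 < - d / (4 * (rnorm h + 1)) by rewrite divr_gt0//; lra.
  have d20 : 0 < - d / 2 by lra.
  have [N hN] := uz _ e0; have [n hn] := inv_small _ d20.
  pose k := maxn N n.
  have := hN k (leq_maxl _ _); have := inv_mono n k (leq_maxr _ _).
  rewrite ltr_pdivlMr; last lra.
  have := mJ (u k + h); rewrite JD; have := hu k.
  have : rdot h (u k) <= rdot h z + rnorm h * rnorm (z - u k).
    have := rdot_le (- h) (z - u k).
    by rewrite !rdotE {1}/rnorm normrN -/(rnorm h); lra.
  have := rnorm_ge0 (z - u k); move: hn.
  move: (n.+1%:R^-1 : R) (k.+1%:R^-1 : R) => a b; rewrite /d; lra.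
pose c := rdot x z - g x.
have rdotB (r : R) : 0 <= r ^+ 2 * rnorm x ^+ 2 + 2 * r * c.
  have := quad (r%:C *: x); rewrite rnormZ rnorm_real exprMn real_normK ?num_real//.
  by rewrite rdotZl gZ /c; nra.
apply/eqP; rewrite eq_sym -subr_eq0 -/c; apply/eqP.
have n1 : 0 < rnorm x ^+ 2 + 1 by rewrite ltr_wpDl ?sqr_ge0.
(* The minimum over [r] of the quadratic polynomial in [rdotB] is negative
   unless [c = 0]; the denominator [|x|^2 + 1] avoids dividing by [|x| = 0]. *)
have := rdotB (- c / (rnorm x ^+ 2 + 1)).
rewrite -(pmulr_rge0 _ (exprn_gt0 2 n1)).
set a := rnorm x ^+ 2 in n1 *.
have -> : (a + 1) ^+ 2 * ((- c / (a + 1)) ^+ 2 * a + 2 * (- c / (a + 1)) * c) =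
  - (c ^+ 2 * (a + 2)) by field; rewrite gt_eqF.
have a0 : 0 <= a by rewrite sqr_ge0.
move=> h; apply/eqP; rewrite -sqrf_eq0 eq_le sqr_ge0 andbT; nra.
Qed.

End Riesz.

(** * Bounded operators and adjoints *)

Section BoundedOperators.
Variable R : realType.
Implicit Types H : hilbertType R.

Lemma bounded_opP H1 H2 (T : H1 -> H2) : bounded_op T ->
  exists2 M : R, 0 <= M & forall x, rnorm (T x) <= M * rnorm x.
Proof.
move=> [M hM]; exists `|M| => // x.
have : rnorm (T x) <= M * rnorm x by rewrite -lecR rmorphM /= !rnormE.
by move/le_trans; apply; rewrite ler_wpM2r ?rnorm_ge0 ?ler_norm.
Qed.

Lemma rnorm_bounded_op H1 H2 (T : H1 -> H2) (M : R) :
  (forall x, rnorm (T x) <= M * rnorm x) -> bounded_op T.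
Proof. by move=> hM; exists M => x; rewrite -!rnormE -rmorphM lecR. Qed.

Lemma bounded_op_comp H1 H2 H3 (T : H2 -> H3) (U : H1 -> H2) :
  bounded_op T -> bounded_op U -> bounded_op (T \o U).
Proof.
move=> /bounded_opP[M M0 hM] /bounded_opP[N N0 hN].
apply: (@rnorm_bounded_op _ _ _ (M * N)) => x /=; apply: le_trans (hM _) _.
by rewrite -mulrA ler_wpM2l.
Qed.

Lemma bounded_op_add H1 H2 (T U : H1 -> H2) :
  bounded_op T -> bounded_op U -> bounded_op (T \+ U).
Proof.
move=> /bounded_opP[M M0 hM] /bounded_opP[N N0 hN].
apply: (@rnorm_bounded_op _ _ _ (M + N)) => x /=.
by apply: le_trans (rnorm_triangle _ _) _; rewrite mulrDl lerD.
Qed.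

Definition adjoint_pair H1 H2 (T : H1 -> H2) (T' : H2 -> H1) :=
  forall x y, inner (T x) y = inner x (T' y).

Lemma adjoint_pair_sym H1 H2 (T : H1 -> H2) T' :
  adjoint_pair T T' -> adjoint_pair T' T.
Proof. by move=> h x y; rewrite innerC -h -innerC. Qed.

Lemma adjoint_pair_comp H1 H2 H3 (T : H2 -> H3) (U : H1 -> H2) T' U' :
  adjoint_pair T T' -> adjoint_pair U U' -> adjoint_pair (T \o U) (U' \o T').
Proof. by move=> hT hU x y; rewrite /= hT hU. Qed.

Lemma adjoint_pair_add H1 H2 (T U : H1 -> H2) T' U' :
  adjoint_pair T T' -> adjoint_pair U U' -> adjoint_pair (T \+ U) (T' \+ U').
Proof. by move=> hT hU x y; rewrite /= innerDl innerDr hT hU. Qed.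

(** Uniqueness of the vector chosen in [adjoint]. *)
Lemma adjoint_pair_eq H1 H2 (T : H1 -> H2) T' :
  adjoint_pair T T' -> adjoint T = T'.
Proof.
move=> h; apply/funext => y; apply: inner_injr => x.
rewrite -h /adjoint; set P := (X in get X).
by have /(_ x) -> : P (get P) by apply: getPex; exists (T' y) => z; rewrite h.
Qed.

Lemma adjoint_pair_linear H1 H2 (T : H1 -> H2) T' :
  adjoint_pair T T' -> linear T'.
Proof.
move=> h a x y; apply: inner_injr => z.
by rewrite -h !innerDr !innerZr !h.
Qed.

(** From [|T' y|^2 = <T (T' y), y>]. *)
Lemma adjoint_pair_bounded H1 H2 (T : H1 -> H2) T' :
  adjoint_pair T T' -> bounded_op T -> bounded_op T'.
Proof.
move=> h /bounded_opP[M M0 hM]; apply: (@rnorm_bounded_op _ _ _ M) => y.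
have [->|Ty0] := eqVneq (T' y) 0.
  by rewrite /rnorm normr0 mulr_ge0 ?rnorm_ge0.
have Ty_gt0 : 0 < rnorm (T' y) by rewrite lt_def rnorm_eq0 Ty0 rnorm_ge0.
rewrite -(ler_pM2l Ty_gt0) -expr2 sqr_rnorm /rdot -h.
apply: le_trans (rdot_le _ _) _.
by rewrite mulrA [_ * M]mulrC ler_wpM2r ?rnorm_ge0.
Qed.

(** The Riesz theorem is applied to the real part of [<T x, y>]; testing the
    resulting identity on multiples [c *: x] gives back the complex one. *)
Lemma adjoint_exists H1 H2 (T : {linear H1 -> H2}) : bounded_op T ->
  exists2 T' : {linear H2 -> H1}, adjoint_pair T T' & bounded_op T'.
Proof.
move=> bT; have [M M0 hM] := bounded_opP bT.
have /choice[T' hT'] y : exists z, forall x, inner (T x) y = inner x z.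
  have [] := @riesz_real _ H1 (fun x => rdot (T x) y) (M * rnorm y).
  - by move=> x x'; rewrite linearD rdotDl.
  - by move=> r x; rewrite linearZ rdotZl.
  - move=> x; apply: le_trans (rdot_le _ _) _.
    by rewrite mulrAC ler_wpM2r ?rnorm_ge0.
  move=> z hz; exists z => x; apply/eqP; rewrite -subr_eq0; apply/eqP.
  apply: Re_scale_eq0 => c; rewrite mulrBr ReD ReN -!innerZl -linearZ.
  by have := hz (c *: x); rewrite /rdot => ->; rewrite subrr.
have pT : adjoint_pair T T' by move=> x y; apply: hT'.
pose L : {linear H2 -> H1} :=
  HB.pack T' (GRing.isLinear.Build _ _ _ _ T' (adjoint_pair_linear pT)).
by exists L => //; apply: adjoint_pair_bounded pT bT.
Qed.

(** * Operator norm and numerical radius *)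

Lemma le_opnorm H1 H2 (T : {linear H1 -> H2}) x : bounded_op T ->
  rnorm (T x) <= opnorm T * rnorm x.
Proof.
move=> /bounded_opP[M M0 hM].
have [->|x0] := eqVneq x 0; first by rewrite linear0 /rnorm !normr0 mulr0.
have xgt0 : 0 < rnorm x by rewrite lt_def rnorm_eq0 x0 rnorm_ge0.
pose u := ((rnorm x)^-1)%:C *: x.
have nu : rnorm u = 1.
  by rewrite rnormZ rnorm_real ger0_norm ?invr_ge0 ?rnorm_ge0// mulVf ?gt_eqF.
have <- : rnorm (T u) * rnorm x = rnorm (T x).
  rewrite linearZ rnormZ rnorm_real ger0_norm ?invr_ge0 ?rnorm_ge0//.
  by rewrite mulrAC mulVf ?mul1r ?gt_eqF.
rewrite ler_wpM2r ?rnorm_ge0//; apply: ub_le_sup.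
  exists M => _ [v /= v1 <-]; apply: le_trans (hM v) _.
  by rewrite -[leRHS]mulr1 ler_wpM2l// -lecR rnormE.
by exists u => //=; rewrite -rnormE nu.
Qed.

(** An empty or unbounded set has supremum [0] by convention. *)
Lemma sup_ge0 (E : set R) : (forall r, E r -> 0 <= r) -> 0 <= sup E.
Proof.
move=> E0; have [supE|/sup_out->//] := pselect (has_sup E).
have [[r Er] _] := supE.
exact: le_trans (E0 r Er) (sup_upper_bound supE Er).
Qed.

Lemma opnorm_ge0 H1 H2 (T : {linear H1 -> H2}) : 0 <= opnorm T.
Proof.
by apply: sup_ge0 => _ [x _ <-]; apply: (rnorm_ge0 (T x)).
Qed.

Lemma numradius_ge0 H (T : H -> H) : 0 <= numradius T.
Proof. by apply: sup_ge0 => _ [x _ <-]; apply: (rnorm_ge0 (inner (T x) x)). Qed.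

Lemma le_numradius H (T : {linear H -> H}) x : bounded_op T ->
  rnorm (inner (T x) x) <= numradius T * rnorm x ^+ 2.
Proof.
move=> /bounded_opP[M M0 hM].
have [->|x0] := eqVneq x 0.
  by rewrite linear0r /rnorm !normr0 expr0n mulr0.
have xgt0 : 0 < rnorm x by rewrite lt_def rnorm_eq0 x0 rnorm_ge0.
pose u := ((rnorm x)^-1)%:C *: x.
have nu : rnorm u = 1.
  by rewrite rnormZ rnorm_real ger0_norm ?invr_ge0 ?rnorm_ge0// mulVf ?gt_eqF.
have <- : rnorm (inner (T u) u) * rnorm x ^+ 2 = rnorm (inner (T x) x).
  have -> : T u = ((rnorm x)^-1)%:C *: T x by rewrite linearZ.
  rewrite innerZl innerZr !rnormM rnorm_conj rnorm_real.
  by rewrite ger0_norm ?invr_ge0 ?rnorm_ge0//; field; rewrite gt_eqF.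
rewrite ler_wpM2r ?sqr_ge0//; apply: ub_le_sup.
  exists M => _ [v /= v1 <-]; apply: le_trans (rnorm_inner _ _) _.
  have v1' : rnorm v = 1 by apply: complexI; rewrite rnormE.
  by rewrite v1' mulr1; apply: le_trans (hM v) _; rewrite v1' mulr1.
by exists u => //=; rewrite -rnormE nu.
Qed.

(** The hypothesis [0 <= r] covers the zero space, whose unit sphere is
    empty. *)
Lemma numradius_le H (T : H -> H) (r : R) : 0 <= r ->
  (forall x, rnorm x = 1 -> rnorm (inner (T x) x) <= r) -> numradius T <= r.
Proof.
move=> r0 h; rewrite /numradius; set E := [set _ | _ in _].
have [->|/set0P E0] := eqVneq E set0; first by rewrite sup0.
apply: ge_sup => // _ [x /= x1 <-]; apply: h.
by apply: complexI; rewrite rnormE.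
Qed.

End BoundedOperators.

Section SelfAdjoint.
Variable R : realType.

(** The norm of a self-adjoint operator is bounded by its quadratic form:
    [4 Re <K u, v>] is the difference of the form at [u + v] and [u - v], so
    the parallelogram law bounds [Re <K u, v>] by [w (|u|^2 + |v|^2) / 2]. *)
Lemma selfadjoint_norm_le (H : hilbertType R) (K : {linear H -> H}) (w : R) :
  adjoint_pair K K -> 0 <= w ->
  (forall x, `|rdot (K x) x| <= w * rnorm x ^+ 2) ->
  forall x, rnorm (K x) <= w * rnorm x.
Proof.
move=> KK w0 hw x.
have polar u v : rdot (K u) v <= w / 2 * (rnorm u ^+ 2 + rnorm v ^+ 2).
  have Ksym : rdot (K v) u = rdot (K u) v by rewrite /rdot KK -/(rdot _ _) rdotC.
  have /ler_normlP[_ h1] := hw (u + v); have /ler_normlP[h2 _] := hw (u - v).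
  have := parallelogram u v; move: h1 h2.
  rewrite !linearD !linearN !rdotE Ksym.
  set a := rnorm (u + v) ^+ 2; set b := rnorm (u - v) ^+ 2 => h1 h2 hab.
  have -> : w / 2 * (rnorm u ^+ 2 + rnorm v ^+ 2) = w / 4 * (a + b).
    by rewrite hab; field.
  lra.
have [->|x0] := eqVneq x 0; first by rewrite linear0 /rnorm !normr0 mulr0.
have [->|Kx0] := eqVneq (K x) 0.
  by rewrite {1}/rnorm normr0 mulr_ge0 ?rnorm_ge0.
have a0 : 0 < rnorm x by rewrite lt_def rnorm_eq0 x0 rnorm_ge0.
have b0 : 0 < rnorm (K x) by rewrite lt_def rnorm_eq0 Kx0 rnorm_ge0.
(* These multiples of [x] and [K x] have the same norm, which makes the
   arithmetic-geometric mean inequality behind [polar] an equality. *)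
have := polar ((rnorm (K x))%:C *: x) ((rnorm x)%:C *: K x).
rewrite linearZ !rdotE !rnormZ !rnorm_real -sqr_rnorm.
rewrite !ger0_norm ?rnorm_ge0//.
move: (rnorm x) (rnorm (K x)) a0 b0 => a b a0 b0 h.
have ab0 : 0 < a * b * b by rewrite !mulr_gt0.
rewrite -(ler_pM2l ab0); apply: le_trans (le_trans h _); lra.
Qed.

(** The operator is [2 Re (c G)], whose form is [2 Re (c <G x, x>)]. *)
Lemma rotated_real_part_le (H : hilbertType R) (G G' : {linear H -> H})
    (c : R[i]) :
  bounded_op G -> adjoint_pair G G' -> rnorm c = 1 ->
  forall x, rnorm (c *: G x + c^*%R *: G' x) <= 2 * numradius G * rnorm x.
Proof.
move=> bG GG' c1.
pose K : {linear H -> H} := (c \*: G) \+ (c^*%R \*: G').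
have KE y : rdot (K y) y = 2 * complex.Re (c * inner (G y) y).
  rewrite /K /= rdotDl [rdot (_ *: G' _) _]rdotC /rdot innerZl innerZr conjCK.
  by rewrite -GG' mulr_natl.
apply: (@selfadjoint_norm_le _ K).
- move=> y z; rewrite /K /= innerDl innerDr !innerZl !innerZr conjCK -GG'.
  by rewrite (adjoint_pair_sym GG') addrC.
- by rewrite mulr_ge0 ?numradius_ge0.
move=> y; rewrite KE normrM ger0_norm// -mulrA ler_wpM2l//.
apply: le_trans _ (le_numradius y bG).
have -> : rnorm (inner (G y) y) = rnorm (c * inner (G y) y).
  by rewrite rnormM c1 mul1r.
rewrite ler_norml Re_le_rnorm andbT lerNl -ReN.
by apply: le_trans (Re_le_rnorm _) _; rewrite /rnorm normrN.
Qed.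

End SelfAdjoint.

(** * Off-diagonal operator matrices *)

Section OffDiagonal.
Variables (R : realType) (H1 H2 : hilbertType R).
Variables (X : {linear H2 -> H1}) (X' : {linear H1 -> H2}).
Variables (Y : {linear H1 -> H2}) (Y' : {linear H2 -> H1}).
Hypotheses (bX : bounded_op X) (bX' : bounded_op X').
Hypotheses (bY : bounded_op Y) (bY' : bounded_op Y').
Hypotheses (XX' : adjoint_pair X X') (YY' : adjoint_pair Y Y').

Let S : {linear H2 -> H2} := (X' \o X) \+ (Y \o Y').
Let G : {linear H2 -> H2} := Y \o X.
Let G' : {linear H2 -> H2} := X' \o Y'.
Let C : R := opnorm S ^+ 2 + 4 * numradius G ^+ 2
  + 2 * numradius ((G \o S) \+ (S \o G)).

Let bS : bounded_op S.
Proof. by apply: bounded_op_add; apply: bounded_op_comp. Qed.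

Let bG : bounded_op G.
Proof. exact: bounded_op_comp. Qed.

Let SS : adjoint_pair S S.
Proof.
apply: adjoint_pair_add.
  exact: adjoint_pair_comp (adjoint_pair_sym XX') XX'.
exact: adjoint_pair_comp YY' (adjoint_pair_sym YY').
Qed.

Let GG' : adjoint_pair G G'.
Proof. exact: adjoint_pair_comp YY' XX'. Qed.

(** With [A = e X + conj(e) Y'] this is [A' A = S + 2 Re (e^2 G)], read through
    the quadratic form at [y]. *)
Lemma sqr_rnorm_block (e : R[i]) y : rnorm e = 1 ->
  rnorm (e *: X y + e^*%R *: Y' y) ^+ 2 =
  rdot (S y + ((e ^+ 2) *: G y + (e ^+ 2)^*%R *: G' y)) y.
Proof.
move=> e1; have e1' : rnorm e^*%R = 1 by rewrite rnorm_conj.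
rewrite sqr_rnorm !(rdotDl, rdotDr) (rdotC (_ *: Y' y) (_ *: X y)).
rewrite !rdot_unimodular//.
have -> : rdot (X' (X y)) y = rdot (X y) (X y) by rewrite rdotC /rdot XX'.
have -> : rdot (Y (Y' y)) y = rdot (Y' y) (Y' y) by rewrite /rdot YY'.
have -> : rdot ((e ^+ 2)^*%R *: G' y) y = rdot (e ^+ 2 *: G y) y.
  by rewrite rdotC /rdot innerZl innerZr conjCK GG'.
have -> : rdot (e *: X y) (e^*%R *: Y' y) = rdot (e ^+ 2 *: G y) y.
  by rewrite /rdot !innerZl innerZr conjCK mulrA -expr2 YY'.
ring.
Qed.

(** Cauchy-Schwarz turns the quadratic form of [A' A = S + K] into
    [|(S + K) y| |y|], whose square is expanded into [C |y|^4]. *)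
Lemma rnorm_block_le (e : R[i]) y : rnorm e = 1 ->
  rnorm (e *: X y + e^*%R *: Y' y) ^+ 4 <= C * rnorm y ^+ 4.
Proof.
move=> e1; set c := e ^+ 2; set K := c *: G y + c^*%R *: G' y.
have c1 : rnorm c = 1 by rewrite /c expr2 rnormM e1 mulr1.
have K_le : rnorm K <= 2 * numradius G * rnorm y by apply: rotated_real_part_le.
have S_le : rnorm (S y) <= opnorm S * rnorm y by apply: le_opnorm.
have SK_le : rdot (S y) K <= numradius ((G \o S) \+ (S \o G)) * rnorm y ^+ 2.
  have -> : rdot (S y) K = complex.Re (c * inner (((G \o S) \+ (S \o G)) y) y).
    rewrite /= innerDl mulrDr ReD /K rdotDr addrC; congr (_ + _).
      by rewrite /rdot innerZr conjCK -GG'.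
    by rewrite rdotC /rdot innerZl SS.
  apply: le_trans (Re_le_rnorm _) _; rewrite rnormM c1 mul1r.
  by apply: le_numradius; apply: bounded_op_add; apply: bounded_op_comp.
have B_le : rnorm (S y + K) ^+ 2 <= C * rnorm y ^+ 2.
  move: (K) (S y) K_le S_le SK_le => k s K_le S_le SK_le.
  rewrite sqr_rnorm !rdotE (rdotC k s) -!sqr_rnorm /C.
  have K2 : rnorm k ^+ 2 <= (2 * numradius G * rnorm y) ^+ 2.
    by rewrite ler_pXn2r ?nnegrE ?mulr_ge0 ?numradius_ge0 ?rnorm_ge0.
  have S2 : rnorm s ^+ 2 <= (opnorm S * rnorm y) ^+ 2.
    by rewrite ler_pXn2r ?nnegrE ?mulr_ge0 ?opnorm_ge0 ?rnorm_ge0.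
  nra.
rewrite -[4%N]/(2 * 2)%N !exprM [X in X ^+ 2 <= _]sqr_rnorm_block// -/c -/K.
apply: (@le_trans _ _ ((rnorm (S y + K) * rnorm y) ^+ 2)).
  rewrite ler_pXn2r ?nnegrE ?rdot_le ?mulr_ge0 ?rnorm_ge0//.
  by rewrite -sqr_rnorm_block// sqr_ge0.
by rewrite exprMn expr2 [rnorm y ^+ 2 ^+ 2]expr2 mulrA ler_wpM2r// sqr_ge0.
Qed.

Lemma numradius_offdiag_le : numradius (offdiag X Y) ^+ 4 <= C / 16%:R.
Proof.
have C0 : 0 <= C.
  by rewrite !addr_ge0 ?mulr_ge0 ?opnorm_ge0 ?numradius_ge0.
pose r := Num.sqrt (Num.sqrt (C / 16%:R)).
have r4 : r ^+ 4 = C / 16%:R.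
  by rewrite (exprM r 2 2) !sqr_sqrtr ?sqrtr_ge0// divr_ge0.
rewrite -r4 ler_pXn2r ?nnegrE ?numradius_ge0 ?sqrtr_ge0//.
apply: numradius_le; first exact: sqrtr_ge0.
move=> [x y] v1.
have xy1 : rnorm x ^+ 2 + rnorm y ^+ 2 = 1.
  have := sqr_rnorm ((x, y) : hsum H1 H2); rewrite v1 expr1n => ->.
  by rewrite !sqr_rnorm /rdot -ReD.
have [e e1 eE] := phase (inner (offdiag X Y (x, y)) (x, y)).
have vE : complex.Re (e * inner (offdiag X Y (x, y)) (x, y)) =
    rdot (e *: X y + e^*%R *: Y' y) x.
  rewrite rdotDl [rdot (_ *: Y' y) _]rdotC /rdot -ReD innerZl innerZr conjCK.
  by rewrite -YY' -mulrDr.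
rewrite -(@ler_pXn2r _ 4) ?nnegrE ?rnorm_ge0 ?sqrtr_ge0// r4.
have A0 := rnorm_ge0 (inner (offdiag X Y (x, y)) (x, y)).
move: A0; rewrite -eE vE; set A := _ + _ => A0.
have A4 : rnorm A ^+ 4 <= C * rnorm y ^+ 4 by apply: rnorm_block_le.
have A_le : rdot A x <= rnorm A * rnorm x := rdot_le A x.
apply: (@le_trans _ _ ((rnorm A * rnorm x) ^+ 4)).
  by rewrite ler_pXn2r ?nnegrE ?mulr_ge0 ?rnorm_ge0.
rewrite exprMn; apply: (@le_trans _ _ (C * (rnorm x * rnorm y) ^+ 4)).
  rewrite exprMn [rnorm x ^+ 4 * _]mulrC [leRHS]mulrA.
  by rewrite ler_wpM2r ?exprn_ge0 ?rnorm_ge0.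
rewrite ler_wpM2l//.
(* [|x|^2 + |y|^2 = 1]; the fourth power of this [1/2] is the factor [1/16]. *)
have xy : rnorm x * rnorm y <= 2^-1 by have := sqr_ge0 (rnorm x - rnorm y); nra.
apply: le_trans (_ : (2^-1) ^+ 4 <= _).
  by rewrite ler_pXn2r ?nnegrE ?mulr_ge0 ?rnorm_ge0.
by rewrite exprVn -natrX.
Qed.

End OffDiagonal.

Theorem theorem2p5 (R : realType) (H1 H2 : hilbertType R)
    (X : {linear H2 -> H1}) (Y : {linear H1 -> H2})
    (hX : bounded_op X) (hY : bounded_op Y) :
  let S : H2 -> H2 := abs2 X \+ abs2 (adjoint Y) in
  numradius (offdiag X Y) ^+ 4 <=
    1 / 16%:R * opnorm S ^+ 2
    + 1 / 4%:R * numradius (Y \o X) ^+ 2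
    + 1 / 8%:R * numradius ((Y \o X \o S) \+ (S \o Y \o X)).
Proof.
(* Since the adjoint of [Y'] is [Y] again, [S] becomes [X' X + Y Y']. *)
have [X' XX' bX'] := adjoint_exists hX.
have [Y' YY' bY'] := adjoint_exists hY.
rewrite /abs2 (adjoint_pair_eq XX') (adjoint_pair_eq YY').
rewrite (adjoint_pair_eq (adjoint_pair_sym YY')).
apply: le_trans (numradius_offdiag_le hX bX' hY bY' XX' YY') _.
set a := opnorm _; set b := numradius (Y \o X).
set c := numradius _.
lra.
Qed.
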